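(* Let $(n_k)_{k\in\mathbb{N}}$ be a strictly increasing sequence of positive integers such that $$\liminf_{k\to\infty}\frac{\ln(\ln(n_k))}{\ln(k)}=0.$$ Then $(n_k)_{k\in\mathbb{N}}$ has the $P_1$ property, i.e. there exist infinitely many prime numbers $p$ such that $p$ divides $n_k$ for at least one $k\in\mathbb{N}$.
   Context: Here $\mathbb{N}=\{1,2,3,\dots\}$ and $\ln$ is the natural logarithm. A sequence $(n_k)_{k\in\mathbb{N}}$ of positive integers is said to have the $P_1$ property (written $(n_k)_{k\in\mathbb{N}}\in P_1$) if there exist infinitely many prime numbers dividing at least one term of the sequence. The quotient $\ln(\ln(n_k))/\ln(k)$ is considered for $k\ge 2$ (where it is well defined since $n_k\ge 2$ and $\ln k>0$). *)

(* Defs.v *)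
From mathcomp Require Import all_boot all_order all_algebra.
From mathcomp Require Import all_classical all_reals all_analysis.
Set Implicit Arguments.
Unset Strict Implicit.
Unset Printing Implicit Defensive.

Import Order.TTheory GRing.Theory Num.Theory.

Local Open Scope classical_set_scope.
Local Open Scope ring_scope.

(* A sequence (n_k) with k in {1, 2, ...} is a function [n : nat -> nat] of
   which only the values at [k > 0] are meaningful: [n 0] is never used. *)

Definition positive_terms (n : nat -> nat) : Prop :=
  forall k : nat, (0 < k)%N -> (0 < n k)%N.

Definition strictly_increasing (n : nat -> nat) : Prop :=
  forall k l : nat, (0 < k)%N -> (k < l)%N -> (n k < n l)%N.

Definition P1 (n : nat -> nat) : Prop :=
  infinite_set [set p : nat | prime p /\ exists2 k : nat, (0 < k)%N & (p %| n k)%N].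

(* The values at k = 0, 1, where the quotient is not defined, do not affect the
   inferior limit. The latter is taken in the extended reals because the
   quotient may be unbounded. *)
Definition lnln_quotient (R : realType) (n : nat -> nat) (k : nat) : R :=
  ln (ln (n k)%:R) / ln k%:R.

(* Main.v *)
Require Import Defs.
From mathcomp Require Import all_boot all_order all_algebra.
From mathcomp Require Import all_classical all_reals all_analysis.
From mathcomp Require Import lra.

Import Order.TTheory GRing.Theory Num.Theory.

(** The terms of a sequence with only finitely many prime divisors are too
    sparse. If all of them are below [B], an integer [m <= N] whose prime
    divisors are among them is determined by its exponents, one for each number
    below [B] and each at most [log_2 N]; so at most [(log_2 N + 1) ^ B] such
    integers exist ([smooth_count]). A strictly increasing sequence puts [k] of
    them below [N = n_k], so [k <= (log_2 n_k + 1) ^ B]. Taking logarithms,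
    [ln k <= B (c + ln (ln n_k))] with an absolute constant [c]
    ([ln_le_lnln]). As [ln k] tends to infinity, the constant is eventually
    absorbed at the price of a factor 2, and [ln (ln n_k) / ln k] stays above
    [1 / (2 B)] ([lnln_quotient_lower_bound]); its inferior limit is then
    positive. *)

Lemma logn_le_trunc_log2 (p m : nat) :
  (0 < m)%N -> (logn p m <= trunc_log 2 m)%N.
Proof.
move=> m_gt0; have [p_prime|/negbTE p_nprime] := boolP (prime p); last first.
  by rewrite lognE p_nprime.
apply: trunc_log_max => //.
apply: leq_trans (dvdn_leq m_gt0 (pfactor_dvdnn p m)).
by case: (logn p m) => // e; rewrite leq_exp2r ?prime_gt1.
Qed.

(** Sending [f i] to its vector of exponents is injective, by unique
    factorization; the vector lives in a set of cardinal [(log_2 N + 1) ^ B]. *)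
Lemma smooth_count (B N k : nat) (f : 'I_k -> nat) :
  injective f -> (forall i, 0 < f i <= N)%N ->
  (forall i p, prime p -> p %| f i -> p < B)%N ->
  (k <= (trunc_log 2 N).+1 ^ B)%N.
Proof.
move=> f_inj f_bnd f_smooth.
have f_gt0 i : (0 < f i)%N by case/andP: (f_bnd i).
have log_lt i p : (logn p (f i) < (trunc_log 2 N).+1)%N.
  rewrite ltnS (leq_trans (logn_le_trunc_log2 _ _ (f_gt0 i)))//.
  by apply: leq_trunc_log; case/andP: (f_bnd i).
pose expo i := [ffun p : 'I_B => Ordinal (log_lt i p)].
have expo_inj : injective expo.
  move=> i j /ffunP eq_ij; apply/f_inj/eqn_from_log => // p.
  have [p_lt|p_ge] := ltnP p B.
    by have := congr1 val (eq_ij (Ordinal p_lt)); rewrite !ffunE.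
  (* a prime that is at least [B] occurs in neither term *)
  have log0 l : logn p (f l) = 0%N.
    apply/eqP; rewrite -leqn0 leqNgt logn_gt0 mem_primes.
    apply/negP => /and3P[p_prime _ /(f_smooth _ _ p_prime)].
    by rewrite ltnNge p_ge.
  by rewrite !log0.
by have := leq_card _ expo_inj; rewrite card_ffun !card_ord.
Qed.

Local Open Scope ring_scope.

(** With [L = trunc_log 2 N], this combines the logarithms of [L + 1 <= 2 L] and
    of [L ln 2 <= ln N]. The bound [N >= 2] gives [L >= 1], which the first
    inequality and the rule [ln (L ln 2) = ln L + ln (ln 2)] require. *)
Lemma ln_le_lnln (R : realType) (B N k : nat) :
  (2 <= N)%N -> (0 < k)%N -> (k <= (trunc_log 2 N).+1 ^ B)%N ->
  ln k%:R <= B%:R * (ln 2 - ln (ln 2) + ln (ln N%:R)) :> R.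
Proof.
move=> N_ge2 k_gt0 k_le; set L := trunc_log 2 N in k_le.
have L_gt0 : (0 < L)%N by apply: trunc_log_max.
have ln2_gt0 : 0 < ln 2 :> R by apply: ln_gt0; rewrite ltr1n.
have lnk_le : ln k%:R <= B%:R * ln L.+1%:R :> R.
  rewrite mulr_natl -lnXn ?ltr0n// -natrX ler_ln ?posrE ?ltr0n ?expn_gt0//.
  by rewrite ler_nat.
apply: le_trans lnk_le _; apply: ler_wpM2l; first exact: ler0n.
have : ln L.+1%:R <= ln 2 + ln L%:R :> R.
  rewrite -lnM ?posrE ?ltr0n// ler_ln ?posrE ?ltr0n ?mulr_gt0 ?ltr0n//.
  by rewrite -natrM ler_nat mul2n -addnn -[in leqLHS]addn1 leq_add2l.
have : ln L%:R + ln (ln 2) <= ln (ln N%:R) :> R.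
  have lnN_gt0 : 0 < ln N%:R :> R by apply: ln_gt0; rewrite ltr1n.
  rewrite -lnM ?posrE ?ltr0n// ler_ln ?posrE ?mulr_gt0 ?ltr0n//.
  rewrite mulr_natl -lnXn ?ltr0n// -natrX.
  rewrite ler_ln ?posrE ?ltr0n ?expn_gt0 ?(ltnW N_ge2)//.
  by rewrite ler_nat trunc_logP// ltnW.
by lra.
Qed.

(** The count applies to the [k] distinct integers [n 1, ..., n k], which are
    all at most [n k]. *)
Lemma lnln_quotient_lower_bound (R : realType) (n : nat -> nat) (B : nat) :
  positive_terms n -> strictly_increasing n -> (0 < B)%N ->
  (forall k p, (0 < k)%N -> prime p -> (p %| n k)%N -> (p < B)%N) ->
  exists K, forall k, (K <= k)%N -> (2 * B%:R)^-1 <= lnln_quotient R n k.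
Proof.
move=> n_pos n_incr B_gt0 n_smooth.
have n_inj k l : (0 < k)%N -> (0 < l)%N -> n k = n l -> k = l.
  move=> k_gt0 l_gt0 nkl; case: (ltngtP k l) => // lt_kl.
    by have := n_incr _ _ k_gt0 lt_kl; rewrite nkl ltnn.
  by have := n_incr _ _ l_gt0 lt_kl; rewrite nkl ltnn.
have n_homo k l : (0 < k)%N -> (k <= l)%N -> (n k <= n l)%N.
  by move=> k_gt0; rewrite leq_eqVlt => /predU1P[->//|/(n_incr _ _ k_gt0)/ltnW].
pose c : R := ln 2 - ln (ln 2).
(* beyond [K], [ln k] is at least [2 B c], so that [c <= ln k / (2 B)] *)
exists (maxn 2 (Num.truncn (expR (2 * B%:R * c))).+1) => k.
rewrite geq_max => /andP[k_ge2 k_large].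
have k_gt0 : (0 < k)%N by apply: ltnW.
have nk_ge2 : (2 <= n k)%N.
  by apply: leq_ltn_trans (n_incr 1%N k isT k_ge2); apply: n_pos.
have count : (k <= (trunc_log 2 (n k)).+1 ^ B)%N.
  apply: (smooth_count B (n k) k (fun i => n i.+1)).
  - by move=> i j nij; apply/val_inj/succn_inj/n_inj.
  - by move=> i; rewrite n_pos//= n_homo.
  - by move=> i p; apply: n_smooth.
have lnk_le := ln_le_lnln R _ _ _ nk_ge2 k_gt0 count; rewrite -/c in lnk_le.
have lnk_gt0 : 0 < ln k%:R :> R by apply: ln_gt0; rewrite ltr1n.
have lnk_large : 2 * B%:R * c <= ln k%:R.
  rewrite -[leLHS]expRK ler_ln ?posrE ?expR_gt0 ?ltr0n//.
  by apply: le_trans (ltW (truncnS_gt _)) _; rewrite ler_nat.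
have B_pos : 0 < B%:R :> R by rewrite ltr0n.
rewrite /lnln_quotient ler_pdivlMr// [leLHS]mulrC ler_pdivrMr ?mulr_gt0//.
by lra.
Qed.

Lemma limn_einf_ge (R : realType) (u : nat -> \bar R) (c : \bar R) (K : nat) :
  (forall k, (K <= k)%N -> (c <= u k)%E) -> (c <= limn_einf u)%E.
Proof.
move=> c_le; rewrite limn_einf_lim (cvg_lim _ (@cvg_einfs_sup _ u))//.
apply: (@le_trans _ _ (einfs u K)); last by apply: ereal_sup_ubound; exists K.
by apply: le_ereal_inf_tmp => _ [k /= K_le <-]; apply: c_le.
Qed.

Local Close Scope ring_scope.

Theorem theorem0p1 (R : realType) (n : nat -> nat)
    (n_pos : positive_terms n) (n_incr : strictly_increasing n)
    (n_liminf : limn_einf (fun k : nat => (lnln_quotient R n k)%:E) = 0%:E) :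
  P1 n.
Proof.
move=> /finite_seqP[s s_primes].
have n_smooth k p : (0 < k)%N -> prime p -> (p %| n k)%N ->
    (p < (\max_(q <- s) q).+1)%N.
  move=> k_gt0 p_prime p_dvd; rewrite ltnS.
  have p_s : p \in s.
    by have : [set` s]%classic p by rewrite -s_primes; split=> //; exists k.
  exact: leq_bigmax_seq p_s isT.
have [K quot_ge] :=
  lnln_quotient_lower_bound R _ _ n_pos n_incr (ltn0Sn _) n_smooth.
have : ((2 * (\max_(q <- s) q).+1%:R)^-1%:E <=
        limn_einf (fun k => (lnln_quotient R n k)%:E))%E.
  by apply: (@limn_einf_ge _ _ _ K) => k Kk; rewrite lee_fin quot_ge.
by rewrite n_liminf lee_fin leNgt invr_gt0 mulr_gt0// ltr0n.
Qed.
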